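(* Let $B\subseteq K_{d,n}$ be a connected bipartite graph. Then for any $d\times n$ tropical matrix $A$ with $B=B_A$, the bounded subcomplex $\mathcal{B}(A)$ of the tropical complex of the arrangement $\mathcal{H}(A)$ satisfies $$\dim(\mathcal{B}(A))\le \lambda(B_A)-1,$$ where $\lambda(B_A)$ is the recession connectivity of $B_A$. Furthermore, if $A$ is sufficiently generic, then equality holds.
   Context: A $d\times n$ tropical matrix is a matrix $A=(a_{ik})$ with entries in $\mathbb{R}\cup\{\infty\}$ such that every column has at least one finite entry. $B_A\subseteq K_{d,n}$ is the bipartite graph on vertex set $[d]\sqcup[n]$ (left nodes $[d]$, right nodes $[n]$) with an edge $(i,k)$ if and only if $a_{ik}$ is finite. Tropical complex. Let $\mathbb{1}\in\mathbb{R}^d$ be the all-ones vector. The $k$-th column $\mathbf{a}_k$ of $A$ is the apex of the max-tropical hyperplane $H(\mathbf{a}_k)$, the set of $\mathbf{p}\in\mathbb{R}^d/\mathbb{R}\mathbb{1}$ for which $\max_i(p_i-a_{ik})$ is attained at least twice (terms with $a_{ik}=\infty$ count as $-\infty$); $\mathcal{H}(A)$ is the arrangement of these $n$ hyperplanes. Its $i$-th closed sector is $S_i(\mathbf{a}_k)=\{\mathbf{p}: p_i-a_{ik}\ge p_j-a_{jk}\ \forall j\in[d]\}$. The fine type of $\mathbf{p}\in\mathbb{R}^d/\mathbb{R}\mathbb{1}$ is $T(\mathbf{p})\in\{0,1\}^{d\times n}$ with $T(\mathbf{p})_{ik}=1$ iff $a_{ik}$ is finite and $\mathbf{p}\in S_i(\mathbf{a}_k)$.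 For each fine type $T$ that occurs, the closed cell of type $T$ is $C_T=\{\mathbf{q}: T(\mathbf{q})\ge T \text{ entrywise}\}$. These cells form a polyhedral subdivision $\mathcal{C}(A)$ of $\mathbb{R}^d/\mathbb{R}\mathbb{1}\cong\mathbb{R}^{d-1}$, the tropical complex. The bounded subcomplex $\mathcal{B}(A)$ consists of its bounded cells. Genericity. The root polytope of $B$ is $Q_B=\mathrm{conv}\{\mathbf{e}_i-\mathbf{e}_{\bar j} : (i,j)\in E(B)\}\subset\mathbb{R}^{d+n}$, where $\mathbf{e}_1,\dots,\mathbf{e}_d,\mathbf{e}_{\bar1},\dots,\mathbf{e}_{\bar n}$ are the coordinate vectors. $\mathcal{S}(A)$ is the regular subdivision of $Q_{B_A}$ obtained by lifting the vertex $\mathbf{e}_i-\mathbf{e}_{\bar j}$ to height $a_{ij}$ and projecting the lower faces. $A$ is sufficiently generic if $\mathcal{S}(A)$ is a triangulation. Recession connectivity. For a bipartite graph $B$ with bipartition $[d]\sqcup[n]$ and a subgraph $S\subseteq B$, the recession graph $R(S;B)$ is the directed graph on vertex set $V(B)$ in which every edge of $E(B)\setminus E(S)$ is directed from $[d]$ to $[n]$ and every edge of $S$ is bidirected. With $c(S)$ the number of connected components of $S$, $$\lambda(B)=\max_{S\subseteq B}\{c(S) : R(S;B)\text{ is strongly connected}\}.$$ *)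

(* Defs.v *)
From HB Require Import structures.
From mathcomp Require Import all_boot all_order all_algebra.
From mathcomp Require Import all_classical all_reals all_analysis.

Set Implicit Arguments.
Unset Strict Implicit.
Unset Printing Implicit Defensive.

Import Order.TTheory GRing.Theory Num.Theory.
Import numFieldNormedType.Exports.

Local Open Scope classical_set_scope.
Local Open Scope ring_scope.

(* A bipartite graph on [d] + [n] is given by its set of edges
   S : {set 'I_d * 'I_n}; its vertex set is always the whole of 'I_d + 'I_n,
   so isolated nodes count as connected components. *)

Section BipartiteGraphs.
Variables d n : nat.

Definition edge_rel (S : {set 'I_d * 'I_n}) : rel ('I_d + 'I_n) :=
  fun x y => match x, y with
  | inl i, inr k => (i, k) \in S
  | inr k, inl i => (i, k) \in S
  | _, _ => false
  end.

Definition num_components (S : {set 'I_d * 'I_n}) : nat :=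
  n_comp (edge_rel S) predT.

Definition connected_graph (S : {set 'I_d * 'I_n}) : bool :=
  (0 < #|{: 'I_d + 'I_n}|)%N && [forall x, forall y, connect (edge_rel S) x y].

Definition recession_graph (S B : {set 'I_d * 'I_n}) : rel ('I_d + 'I_n) :=
  fun x y => match x, y with
  | inl i, inr k => ((i, k) \in B :\: S) || ((i, k) \in S)
  | inr k, inl i => (i, k) \in S
  | _, _ => false
  end.

Definition strongly_connected (T : finType) (e : rel T) : bool :=
  [forall x, forall y, connect e x y].

Definition recession_connectivity (B : {set 'I_d * 'I_n}) : nat :=
  \max_(S : {set 'I_d * 'I_n}
        | (S \subset B) && strongly_connected (recession_graph S B))
     num_components S.

End BipartiteGraphs.

Section ConvexGeometry.
Variables (R : realType) (V : lmodType R).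

(* Affine independence of the images of q_0, ..., q_(k-1) in V / L, for a
   linear subspace L of V; the usual notion in V is the case L = [set 0]. *)
Definition affinely_independent_mod (L : set V) k (q : 'I_k -> V) : Prop :=
  forall c : 'I_k -> R,
    \sum_i c i = 0 -> L (\sum_i c i *: q i) -> forall i, c i = 0.

Definition convex_hull (I : finType) (P : {set I}) (v : I -> V) : set V :=
  [set x | exists c : I -> R,
     [/\ forall i, i \in P -> 0 <= c i,
         \sum_(i in P) c i = 1 &
         x = \sum_(i in P) c i *: v i]].

(* k = 0 is allowed: the empty set is a simplex. *)
Definition is_simplex (X : set V) : Prop :=
  exists k (q : 'I_k -> V),
    affinely_independent_mod [set 0] q /\ X = convex_hull [set: 'I_k] q.

End ConvexGeometry.

Section TropicalTorus.
Variables (R : realType) (d : nat).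

(* Points of R^d / R1 are handled through representatives in R^d = 'rV_d, and
   subsets of R^d / R1 through their R1-invariant preimages in R^d. *)
Definition all_ones_line : set 'rV[R]_d :=
  [set p | exists t : R, p = t *: const_mx 1].

(* The image of X in R^d / R1 is bounded: it is contained in the image of a
   bounded subset of R^d. *)
Definition torus_bounded (X : set 'rV[R]_d) : Prop :=
  exists2 Y : set 'rV[R]_d, bounded_set Y &
    forall p, X p -> exists2 y, Y y & all_ones_line (p - y).

(* Dimension of the affine hull of the image of X in R^d / R1 (-1 if X is
   empty): one less than the maximal number of affinely independent points,
   which is at most d since R^d / R1 has dimension d - 1. *)
Definition torus_dim (X : set 'rV[R]_d) : int :=
  (\max_(k < d.+1 | `[< exists q : 'I_k -> 'rV[R]_d,
       (forall i, X (q i)) /\ affinely_independent_mod all_ones_line q >])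
    (k : nat))%:Z - 1.

(* Maximal dimension of a cell, -1 for a complex without nonempty cells. *)
Definition complex_dim (K : set (set 'rV[R]_d)) : int :=
  (\max_(k < d.+1 | `[< exists2 C, K C & torus_dim C = (k : nat)%:Z - 1 >])
    (k : nat))%:Z - 1.

End TropicalTorus.

Section TropicalMatrices.
Variables (R : realType) (d n : nat).
Implicit Types (A : 'M[\bar R]_(d, n)) (p q : 'rV[R]_d) (T : 'M[bool]_(d, n)).

Definition tropical_matrix A : Prop :=
  (forall i k, A i k != -oo%E) /\
  (forall k, exists i, A i k \is a fin_num).

Definition support_graph A : {set 'I_d * 'I_n} :=
  [set ik | A ik.1 ik.2 \is a fin_num]%SET.

(* If A j k = +oo then p_j - A j k = -oo in \bar R, and in_sector is false
   at a row i with A i k = +oo because column k has a finite entry. *)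
Definition in_sector A (k : 'I_n) (i : 'I_d) p : bool :=
  [forall j, ((p 0 j)%:E - A j k <= (p 0 i)%:E - A i k)%E].

Definition fine_type A p : 'M[bool]_(d, n) :=
  \matrix_(i, k) ((A i k \is a fin_num) && in_sector A k i p).

Definition cell A T : set 'rV[R]_d :=
  [set q | forall i k, T i k -> fine_type A q i k].

Definition tropical_complex A : set (set 'rV[R]_d) :=
  [set C | exists p, C = cell A (fine_type A p)].

Definition bounded_subcomplex A : set (set 'rV[R]_d) :=
  [set C | tropical_complex A C /\ torus_bounded C].

Definition root_vertex (e : 'I_d * 'I_n) : 'rV[R]_(d + n) :=
  delta_mx 0 (lshift n e.1) - delta_mx 0 (rshift d e.2).

(* The root polytope of B_A is the projection of this polytope to the first
   factor of R^(d+n) x R; the second factor is the height. *)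
Definition lifted_polytope A : set ('rV[R]_(d + n) * R^o) :=
  convex_hull (support_graph A)
    (fun e => (root_vertex e, fine (A e.1 e.2) : R^o)).

(* The faces minimizing a linear functional whose coefficient on the height
   is positive, normalized to 1. *)
Definition lower_face m (P F : set ('rV[R]_m * R^o)) : Prop :=
  exists u : 'rV[R]_m, F = [set x | P x /\ forall y, P y ->
    \sum_j u 0 j * x.1 0 j + x.2 <= \sum_j u 0 j * y.1 0 j + y.2].

Definition regular_subdivision A : set (set 'rV[R]_(d + n)) :=
  [set C | exists2 F, lower_face (lifted_polytope A) F & C = fst @` F].

Definition sufficiently_generic A : Prop :=
  forall C, regular_subdivision A C -> is_simplex C.

End TropicalMatrices.

(* Main.v *)
Require Import Defs.
From mathcomp Require Import all_boot all_order all_algebra.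
From mathcomp Require Import all_classical all_reals all_analysis.
From mathcomp Require Import ring lra.

(** A point p determines the graph T(p) of its fine type, a subgraph of B.
    Within the closed cell of p one can move away from p, in both directions,
    exactly along the vectors that are constant on the components of T(p), so
    this cell has dimension c(T(p)) - 1 ([independent_le_components],
    [cell_independent]).  On the cell, q_j - q_i is bounded above as soon as
    i is reachable from j in R(T(p); B), while the indicator of a reachable
    set that misses some left node is a recession direction; hence the cell
    is bounded iff R(T(p); B) is strongly connected
    ([bounded_strongly_connected]).  The graph T(p) of a bounded cell thus
    competes in the maximum defining lambda(B), which gives the inequality.

    For the equality one needs a point p such that R(T(p); B) is strongly
    connected and c(T(p)) >= lambda(B).  Start from an optimal S.  A subgraph
    F of S that is minimal with R(F; B) strongly connected has linearly
    independent incidence vectors, so |F| <= d + n - lambda(B)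
    ([exists_small_support]).  View the indicator of F as a transport plan
    from left to right nodes, and let f be a plan of least cost, for the cost
    a_ik, among the natural number valued plans on B with the same row and
    column sums.
    - Strong connectivity of R(supp f; B) depends on the margins of f only
      ([recession_transport]), so it is inherited from F.
    - The mass of f is |F|, so |supp f| <= |F|.
    - Optimality of f gives dual potentials p and w such that
      p_i - a_ik <= w_k, with equality on supp f ([optimal_potentials]): they
      are shortest path lengths in the residual network, which has no
      negative cycle.  Working with cycles keeps the plans integral.
    - The edges that are tight for some potentials span a lower face of the
      lifted root polytope.  If A is generic this face is a simplex, so these
      edges carry at most one plan with given margins and f is the only
      optimal plan ([generic_independent], [generic_optimum_unique]).
      Lowering the costs slightly outside supp f then keeps f optimal, and
      the potentials for the lowered costs are tight on supp f only
      ([strict_complementarity]), which says that T(p) = supp f.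
    Since a graph with m edges has at least d + n - m components, c(T(p)) is
    at least d + n - |F| >= lambda(B). *)

Set Implicit Arguments.
Unset Strict Implicit.
Unset Printing Implicit Defensive.

Import Order.TTheory GRing.Theory Num.Theory.
Import numFieldNormedType.Exports.

Local Open Scope ring_scope.

(** * Components and linear algebra *)

Lemma nontrivial_solution (R : fieldType) (I J : finType) (M : I -> J -> R) :
  (#|J| < #|I|)%N ->
  exists2 g : I -> R, exists i, g i != 0 & forall j, \sum_i g i * M i j = 0.
Proof.
move=> ltJI.
pose N := \matrix_(i < #|I|, j < #|J|) M (enum_val i) (enum_val j).
have : kermx N != 0.
  rewrite -mxrank_eq0 mxrank_ker subn_eq0 -ltnNge.
  exact: leq_ltn_trans (rank_leq_col N) ltJI.
move=> /matrix0Pn [i [k nz]].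
exists (fun x => kermx N i (enum_rank x)).
  by exists (enum_val k); rewrite enum_valK.
move=> j; have /matrixP/(_ i (enum_rank j)) := mulmx_ker N.
rewrite !mxE => eq0; rewrite -[RHS]eq0.
rewrite [RHS](reindex enum_rank); last exact/onW_bij/enum_rank_bij.
by apply: eq_bigr => x _; rewrite !mxE !enum_rankK.
Qed.

Lemma sum_edges (R : nmodType) d n (F : 'I_d * 'I_n -> R) :
  \sum_e F e = \sum_i \sum_k F (i, k).
Proof. by rewrite pair_bigA; apply: eq_bigr => -[]. Qed.

Lemma closed_connect (T : finType) (e : rel T) (U : pred T) x y :
  (forall x y, e x y -> U x -> U y) -> connect e x y -> U x -> U y.
Proof.
move=> cl /connectP[s ps ->]; elim: s x ps => //= z s IH x /andP[xz ps] Ux.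
exact: IH ps (cl _ _ xz Ux).
Qed.

Section Components.
Variables (R : fieldType) (d n : nat).
Implicit Types S F : {set 'I_d * 'I_n}.
Local Notation V := ('I_d + 'I_n)%type.

Lemma edge_rel_sym S : symmetric (edge_rel S).
Proof. by move=> [i|k] [j|l]. Qed.

Lemma edge_connect_sym S : connect_sym (edge_rel S).
Proof. exact: (sym_connect_sym (edge_rel_sym S)). Qed.

Definition component_root S : V -> V := fingraph.root (edge_rel S).

Lemma component_root_edge S i k : (i, k) \in S ->
  component_root S (inl i) = component_root S (inr k).
Proof. by move=> ik; apply/fingraph.rootP; [exact: edge_connect_sym|exact/connect1]. Qed.

Definition components S : finType := {x | roots (edge_rel S) x}.

Definition component_of S x : components S :=
  exist (fun x => roots (edge_rel S) x) (component_root S x)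
    (roots_root (edge_connect_sym S) x).

Lemma card_components S : #|components S| = num_components S.
Proof.
rewrite card_sig /num_components /n_comp_mem.
by apply: eq_card => x; rewrite !inE andbT.
Qed.

Lemma constant_on_components S (W : Type) (f : V -> W) :
  (forall i k, (i, k) \in S -> f (inl i) = f (inr k)) ->
  forall x, f x = f (component_root S x).
Proof.
rewrite /component_root => fS x; have := connect_root (edge_rel S) x.
move/connectP=> [s ps ->]; elim: s x ps => //= y s IH x /andP[xy ps].
rewrite -IH //; case: x xy => [i|k]; case: y {ps IH} => //= j; first exact: fS.
by move/fS.
Qed.

(** Functions that are constant on components are determined by their values
    at the component roots, so they form a space of dimension c(S). *)
Lemma dependent_on_components S (I : finType) (r : I -> V -> R) :
  (forall c i k, (i, k) \in S -> r c (inl i) = r c (inr k)) ->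
  (num_components S < #|I|)%N ->
  exists2 g : I -> R, exists c, g c != 0 & forall x, \sum_c g c * r c x = 0.
Proof.
move=> rS; rewrite -card_components => /nontrivial_solution.
move=> /(_ _ (fun c x => r c (val x)))[g nz eq0].
exists g => // x; rewrite -[RHS](eq0 (component_of S x)).
apply: eq_bigr => c _; congr (_ * _).
exact: (constant_on_components (rS c)).
Qed.

(** The functions on vertices that agree across every edge of S and vanish at
    every component root are zero; if S had fewer edges and components than
    there are vertices, these conditions would have a nonzero solution. *)
Lemma vertices_le_components_edges S : (d + n <= num_components S + #|S|)%N.
Proof.
rewrite leqNgt; apply/negP => lt.
pose J : finType := (components S + {e | e \in S})%type.
pose M (x : V) (j : J) : R := match j with
  | inl c => (x == val c)%:R
  | inr e => (x == inl (val e).1)%:R - (x == inr (val e).2)%:R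
  end.
have [|f [x nz] f0] := @nontrivial_solution R V J M.
  by rewrite !card_sum !card_ord card_components card_sig.
have ev (y : V) : \sum_z f z * (z == y)%:R = f y.
  rewrite (bigD1 y) //= eqxx mulr1 big1 ?addr0 // => z /negPf ->.
  by rewrite mulr0.
have fS i k : (i, k) \in S -> f (inl i) = f (inr k).
  move=> ik; have := f0 (inr (exist _ (i, k) ik)).
  rewrite /=; under eq_bigr do rewrite mulrBr.
  by rewrite sumrB !ev => /eqP; rewrite subr_eq0 => /eqP.
case/negP: nz; rewrite (constant_on_components fS).
have := f0 (inl (component_of S x)).
by rewrite /= ev => ->.
Qed.

(** The signed margins of edge weights supported in S add up to zero over each
    component of S.  So it suffices to make them vanish at the vertices that
    are not component roots, of which there are only d + n - c(S). *)
Lemma dependent_edges S F : F \subset S ->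
  (d + n < #|F| + num_components S)%N ->
  exists g : 'I_d * 'I_n -> R,
    [/\ exists e, g e != 0, forall e, e \notin F -> g e = 0,
        forall i, \sum_k g (i, k) = 0 & forall k, \sum_i g (i, k) = 0].
Proof.
move=> FS lt.
pose J : finType := {x : V | ~~ roots (edge_rel S) x}.
pose I : finType := {e | e \in F}.
pose M (e : I) (x : J) : R := (inl (val e).1 == val x)%:R - (inr (val e).2 == val x)%:R.
have cJ : (#|J| + num_components S = d + n)%N.
  rewrite -card_components !card_sig addnC.
  have := cardC (roots (edge_rel S)); rewrite card_sum !card_ord => <-.
  by congr (_ + _)%N; apply: eq_card => x; rewrite !inE.
have [|h [e0 nz] h0] := @nontrivial_solution R I J M.
  by rewrite -(ltn_add2r (num_components S)) cJ card_sig.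
pose g e : R := if insub e is Some e' then h e' else 0.
have gF e : e \notin F -> g e = 0 by move=> nF; rewrite /g insubN.
(* The sign makes the contributions of an edge to its two ends cancel. *)
pose b (x : V) := match x with
  | inl i => \sum_k g (i, k) | inr k => - \sum_i g (i, k) end.
have bE x : b x = \sum_e g e * ((inl e.1 == x)%:R - (inr e.2 == x)%:R).
  rewrite sum_edges; case: x => [i|k] /=.
    rewrite [RHS](bigD1 i) //= [X in _ + X]big1 ?addr0.
      by apply: eq_bigr => k _; rewrite eqxx subr0 mulr1.
    move=> j ji; rewrite big1 // => k _; rewrite subr0.
    by rewrite (inj_eq (@inl_inj _ _)) (negPf ji) mulr0.
  rewrite exchange_big (bigD1 k) //= [X in _ + X]big1 ?addr0.
    by rewrite -sumrN; apply: eq_bigr => i _; rewrite eqxx sub0r mulrN1.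
  move=> j ji; rewrite big1 // => i _.
  by rewrite (inj_eq (@inr_inj _ _)) (negPf ji) subr0 mulr0.
have gI (c : _ -> R) : \sum_e g e * c e = \sum_(e : I) h e * c (val e).
  rewrite (bigID (mem F)) /= [X in _ + X]big1 ?addr0 => [|e /gF->]; last by rewrite mul0r.
  rewrite (reindex_omap (val : I -> _) insub) /=; last first.
    by move=> e eF; rewrite insubT.
  apply: eq_big => [e|e _]; last by rewrite /g valK.
  by rewrite (valP e) valK eqxx.
have bJ x : ~~ roots (edge_rel S) x -> b x = 0.
  by move=> nx; rewrite bE gI; exact: (h0 (exist _ x nx)).
have bcomp y : \sum_(x | component_root S x == y) b x = 0.
  under eq_bigr do rewrite bE.
  rewrite exchange_big /= big1 // => e _; rewrite -mulr_sumr sumrB.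
  have sumE z : \sum_(x | component_root S x == y) (z == x)%:R =
      (component_root S z == y)%:R :> R.
    rewrite big_mkcond (bigD1 z) //= eqxx big1 ?addr0 => [|x /negPf xz].
      by case: (_ == _).
    by rewrite [z == x]eq_sym xz; case: ifP.
  rewrite !sumE; have [eF|/gF->] := boolP (e \in F); last by rewrite mul0r.
  rewrite (@component_root_edge S e.1 e.2) ?subrr ?mulr0 //.
  by rewrite -surjective_pairing (fintype.subsetP FS).
have b0 x : b x = 0.
  have [rx|/bJ //] := boolP (roots (edge_rel S) x).
  have := bcomp x; rewrite (bigD1 x) //= big1 ?addr0 // => y /andP[/eqP yx ny].
  by apply: bJ; apply: contra ny => /eqP yy; rewrite -yx -[X in X == _]yy.
exists g; split => //.
- by exists (val e0); rewrite /g valK.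
- by move=> i; exact: (b0 (inl i)).
- by move=> k; apply/eqP; rewrite -oppr_eq0; apply/eqP; exact: (b0 (inr k)).
Qed.

End Components.

(** * Strong connectivity of recession graphs *)

Definition same_margins (W : nmodType) d n (f g : 'I_d * 'I_n -> W) : Prop :=
  (forall i, \sum_k f (i, k) = \sum_k g (i, k)) /\
  (forall k, \sum_i f (i, k) = \sum_i g (i, k)).

Lemma same_margins_sum (R : pzRingType) d n (f g : 'I_d * 'I_n -> R) c b :
  same_margins f g ->
  \sum_e f e * (c e.1 + b e.2) = \sum_e g e * (c e.1 + b e.2).
Proof.
move=> [fr fc].
have E h : \sum_e h e * (c e.1 + b e.2) =
  \sum_i (\sum_k h (i, k)) * c i + \sum_k (\sum_i h (i, k)) * b k.
  under eq_bigr do rewrite mulrDr.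
  rewrite big_split !sum_edges /= [X in _ + X]exchange_big /=.
  by congr (_ + _); apply: eq_bigr => i _; rewrite mulr_suml.
rewrite !E; congr (_ + _).
  by apply: eq_bigr => i _; rewrite fr.
by apply: eq_bigr => i _; rewrite fc.
Qed.

Lemma strongly_connectedP (T : finType) (e : rel T) :
  reflect (forall x y, connect e x y) (strongly_connected e).
Proof. exact: (iffP 'forall_forallP). Qed.

Lemma recession_arc d n (S B : {set 'I_d * 'I_n}) i k : S \subset B ->
  recession_graph S B (inl i) (inr k) = ((i, k) \in B).
Proof.
move=> /fintype.subsetP SB; rewrite /= inE.
by have [/SB->|] := boolP ((i, k) \in S); rewrite ?orbT ?orbF.
Qed.

Definition edge_support (R : nmodType) d n (f : 'I_d * 'I_n -> R) :=
  [set e | f e != 0]%SET.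

(** For a set U of vertices closed under the arcs of R(supp g; B), the weighted
    sum over the edges (i, k) of B of g_ik ([k in U] - [i in U]) vanishes.
    It depends on the margins of g only, so it vanishes for f too; its terms
    are nonnegative for f because U is closed under the arcs of B, so no edge
    of supp f has its right end alone in U and U is closed under
    R(supp f; B). *)
Lemma recession_transport (R : realDomainType) d n (B : {set 'I_d * 'I_n})
    (f g : 'I_d * 'I_n -> R) :
  (forall e, 0 <= f e) -> (forall e, 0 <= g e) ->
  edge_support f \subset B -> edge_support g \subset B -> same_margins f g ->
  strongly_connected (recession_graph (edge_support f) B) ->
  strongly_connected (recession_graph (edge_support g) B).
Proof.
move=> f0 g0 fB gB fg /strongly_connectedP scf; apply/strongly_connectedP => x y.
pose U := connect (recession_graph (edge_support g) B) x.
have Ucl z t : recession_graph (edge_support g) B z t -> U z -> U t.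
  by move=> zt xz; exact: connect_trans xz (connect1 zt).
have UB i k : (i, k) \in B -> U (inl i) -> U (inr k).
  by move=> ik; apply: Ucl; rewrite recession_arc.
pose b k : R := (U (inr k))%:R; pose c i : R := - (U (inl i))%:R.
have gE : \sum_e g e * (c e.1 + b e.2) = 0.
  apply: big1 => -[i k] _; have [->|nz] := eqVneq (g (i, k)) 0; first by rewrite mul0r.
  have eg : (i, k) \in edge_support g by rewrite inE.
  rewrite /c /b /= (_ : U (inl i) = U (inr k)) ?addNr ?mulr0 //.
  apply/idP/idP; last exact: Ucl.
  exact/UB/(fintype.subsetP gB).
have /psumr_eq0P feq : \sum_e f e * (c e.1 + b e.2) = 0.
  by rewrite (same_margins_sum c b fg).
apply: (closed_connect (U := U)) (scf x y) (connect0 _ _).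
move=> [i|k] [j|l] //; first by rewrite recession_arc //; exact: UB.
move=> jk Uk; rewrite /= inE in jk; have := feq _ (j, k) isT.
rewrite /c /b /= Uk.
have e_ge0 e : xpredT e -> 0 <= f e * (c e.1 + b e.2).
  move=> _; have [ef|] := boolP (e \in edge_support f); last first.
    by rewrite inE negbK => /eqP ->; rewrite mul0r.
  apply: mulr_ge0 => //; rewrite /b /c addrC subr_ge0 ler_nat.
  have := @UB e.1 e.2; rewrite -surjective_pairing (fintype.subsetP fB) //.
  by case: (U _) => // ->.
move=> /(_ e_ge0)/eqP; rewrite mulf_eq0 (negPf jk) /=.
by case: (U _) => //; rewrite oppr0 add0r oner_eq0.
Qed.

(** Take F minimal inside S.  If its incidence vectors were dependent, a
    multiple of the dependency could be added to the indicator of F so as to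
    kill an edge while keeping the weights nonnegative and the margins
    unchanged; [recession_transport] would make the smaller support strongly
    connected. *)
Lemma exists_small_support d n (S B : {set 'I_d * 'I_n}) :
  S \subset B -> strongly_connected (recession_graph S B) ->
  exists F : {set 'I_d * 'I_n},
    [/\ F \subset B, strongly_connected (recession_graph F B) &
    (#|F| + num_components S <= d + n)%N].
Proof.
move=> SB scS.
pose P (F : {set _}) := (F \subset S) && strongly_connected (recession_graph F B).
have PS : P S by rewrite /P fintype.subxx.
case: (arg_minnP (fun F : {set _} => #|F|) PS) => F /andP[FS scF] Fmin.
have FB := fintype.subset_trans FS SB.
exists F; split => //; rewrite leqNgt; apply/negP => lt.
have [g [[e1 nz] gF gr gc]] := dependent_edges rat FS lt.
(* Up to a change of sign the dependency has a negative weight. *)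
have [h [e2 neg] [hF hr hc]] : exists2 h : 'I_d * 'I_n -> rat,
   exists e, h e < 0 & [/\ forall e, e \notin F -> h e = 0,
     forall i, \sum_k h (i, k) = 0 & forall k, \sum_i h (i, k) = 0].
  move: nz; rewrite neq_lt => /orP[neg|pos].
    by exists g => //; exists e1.
  exists (fun e => - g e); first by exists e1; rewrite oppr_lt0.
  split=> [e /gF ->|i|k]; first by rewrite oppr0.
    by rewrite sumrN gr oppr0.
  by rewrite sumrN gc oppr0.
case: (@Order.TotalTheory.arg_minP _ _ _ e2 xpredT h isT) => e0 _ hmin.
have neg0 : h e0 < 0 := le_lt_trans (hmin e2 isT) neg.
(* The edge e0 has the most negative weight, so it is the first to vanish. *)
pose o e : rat := (e \in F)%:R; pose f e := o e - h e / h e0.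
have oF : edge_support o = F.
  by apply/setP => e; rewrite inE /o pnatr_eq0; case: (e \in F).
have f_out e : e \notin F -> f e = 0.
  by move=> eF; rewrite /f /o (negPf eF) hF // mul0r subr0.
have fF : edge_support f \subset F.
  apply/fintype.subsetP => e; rewrite inE; apply: contraR => /f_out ->.
  exact: eqxx.
have e0F : e0 \in F.
  by apply: contraLR neg0 => /hF ->; rewrite ltxx.
have f_e0 : f e0 = 0 by rewrite /f /o e0F divff ?subrr // lt_eqF.
have f_ge0 e : 0 <= f e.
  have [eF|/f_out -> //] := boolP (e \in F).
  by rewrite /f /o eF subr_ge0 ler_ndivrMr // mul1r hmin.
have : P (edge_support f).
  rewrite /P (fintype.subset_trans fF FS) /=.
  apply: (@recession_transport _ _ _ _ o f) => //; rewrite ?oF //.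
  - exact: fintype.subset_trans fF FB.
  - by split=> i; rewrite sumrB -mulr_suml ?hr ?hc mul0r subr0.
move=> /Fmin; rewrite leqNgt => /negP; apply; apply: proper_card.
rewrite finset.properEneq fF andbT; apply: contraTneq e0F => <-.
by rewrite inE f_e0 eqxx.
Qed.

(** * Shortest path potentials and optimal transport plans *)

Section Potential.
Variables (R : realDomainType) (V : finType) (e : rel V) (c : V -> V -> R).

Definition path_cost x s : R := \sum_(r <- pairmap c x s) r.

Lemma path_cost_cat x s t :
  path_cost x (s ++ t) = path_cost x s + path_cost (last x s) t.
Proof. by rewrite /path_cost pairmap_cat big_cat. Qed.

Lemma path_cost1 x y : path_cost x [:: y] = c x y.
Proof. by rewrite /path_cost /= big_seq1. Qed.

Hypothesis c_diag : forall x, c x x = 0.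

(** Summing over all vertices is harmless because [next] fixes those that are
    not on the cycle. *)
Lemma cycle_cost x s : uniq (x :: s) ->
  \sum_y c y (next (x :: s) y) = path_cost x (rcons s x).
Proof.
move=> us.
transitivity (\sum_(y in x :: s) c y (next (x :: s) y)).
  rewrite [RHS]big_mkcond; apply: eq_bigr => y _; case: ifPn => // /negPf ys.
  by rewrite next_nth ys.
rewrite -(big_uniq _ us) (big_nth x) big_mkord /path_cost [RHS](big_nth 0) big_mkord.
rewrite size_pairmap size_rcons; apply: eq_bigr => -[i /= lti] _.
rewrite -[next_at _ _ _ _]/(next (x :: s) _) (nth_pairmap x) ?size_rcons //.
rewrite next_nth mem_nth // index_uniq //.
rewrite -rcons_cons [nth x (rcons (x :: s) x) i]nth_rcons /= lti; congr (c _ _).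
rewrite nth_rcons; case: ifP => // /negbT; rewrite -leqNgt => le.
by rewrite nth_default // if_same.
Qed.

(** A path is coded by the sequence of all its vertices, starting anywhere. *)
Definition simple_path_to y t := if t is x :: s then
  [&& path e x s, uniq (x :: s) & last x s == y] else false.

Definition walk_cost t := if t is x :: s then path_cost x s else 0.

(** Simple paths have at most #|V| vertices, so there are finitely many. *)
Lemma exists_cheapest y : exists2 t, simple_path_to y t &
  forall t', simple_path_to y t' -> walk_cost t <= walk_cost t'.
Proof.
pose T : finType := #|V|.-bseq V.
have sz t : simple_path_to y t -> (size t <= #|V|)%N.
  case: t => // x s /and3P[_ us _].
  by move/card_uniqP: us => <-; exact: max_card.
have y1 : simple_path_to y [:: y] by rewrite /= eqxx.
pose t1 : T := Bseq (sz _ y1).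
case: (@Order.TotalTheory.arg_minP _ _ _ t1 (fun t : T => simple_path_to y t)
  (fun t : T => walk_cost t) y1) => t ty tmin.
exists (val t) => // t' t'y; have st := sz _ t'y.
have := tmin (Bseq st); exact.
Qed.

(** The potential of y is the least cost of a simple path ending at y.  If the
    extension of a cheapest path by an arc to z is no longer simple, the path
    already visits z, and cutting off the closed part does not increase the
    cost.  The absence of negative cycles is expressed with injective maps that
    move vertices along arcs, since those are what one can push flow along. *)
Lemma exists_potential :
  (forall sigma : V -> V, injective sigma ->
     (forall x, sigma x != x -> e x (sigma x)) -> 0 <= \sum_x c x (sigma x)) ->
  exists u : V -> R, forall x y, e x y -> u y <= u x + c x y.
Proof.
move=> cyc; pose t y := s2val (cid2 (exists_cheapest y)).
have ty y : simple_path_to y (t y) by exact: (s2valP (cid2 (exists_cheapest y))).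
have tmin y t' : simple_path_to y t' -> walk_cost (t y) <= walk_cost t'.
  exact: (s2valP' (cid2 (exists_cheapest y))).
exists (fun y => walk_cost (t y)) => y z yz.
have := ty y; case: (t y) => // x s /and3P[ps us /eqP sy].
have [zs|zs] := boolP (z \in x :: s); last first.
  have -> : walk_cost (x :: s) + c y z = walk_cost (x :: rcons s z).
    by rewrite /= -cats1 path_cost_cat sy path_cost1.
  have u' : uniq (x :: rcons s z) by rewrite -rcons_cons rcons_uniq zs.
  by apply: tmin; rewrite /simple_path_to rcons_path ps sy yz u' last_rcons eqxx.
case/splitPl: zs ps us sy => s1 s2 s1z.
rewrite cat_path s1z last_cat s1z => /andP[ps1 ps2] us s2y.
have u1 : uniq (x :: s1) by move: us; rewrite -cat_cons cat_uniq => /and3P[].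
have u2 : uniq (z :: s2).
  move: us; rewrite -cat_cons cat_uniq => /and3P[_ /hasPn h u2].
  rewrite /= u2 andbT; apply: contraL (mem_last x s1) => zs2.
  by rewrite s1z h.
apply: (@le_trans _ _ (walk_cost (x :: s1))).
  by apply: tmin; rewrite /= ps1 s1z eqxx andbT.
rewrite /= path_cost_cat s1z -addrA lerDl.
have -> : path_cost z s2 + c y z = path_cost z (rcons s2 z).
  by rewrite -cats1 path_cost_cat s2y path_cost1.
rewrite -cycle_cost //; apply: cyc; first exact: can_inj (prev_next u2).
move=> v nv; apply: next_cycle; first by rewrite /= rcons_path ps2 s2y.
by apply: contraR nv => vs; rewrite next_nth (negPf vs).
Qed.

End Potential.

Section Transport.
Variables (d n : nat) (B : {set 'I_d * 'I_n}).
Local Notation V := ('I_d + 'I_n)%type.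
Local Notation E := ('I_d * 'I_n)%type.

Lemma sum_indicator_sides (y : V) :
  (\sum_i (y == inl i) + \sum_k (y == inr k) = 1)%N.
Proof.
rewrite -(big_sumType _ xpredT (fun x : V => (y == x) : nat)) (bigD1 y) //= eqxx big1 //.
by move=> x /negPf; rewrite eq_sym => ->.
Qed.

Lemma sum_preimage_sides (sigma : V -> V) y : injective sigma ->
  (\sum_i (sigma (inl i) == y) + \sum_k (sigma (inr k) == y) = 1)%N.
Proof.
move=> inj; rewrite -(big_sumType _ xpredT (fun x => (sigma x == y) : nat)).
have [tau _ sK] := injF_bij inj.
rewrite (bigD1 (tau y)) //= sK eqxx big1 // => x.
by move=> xy; case: eqP => // E; case/eqP: xy; apply: inj; rewrite sK.
Qed.

Section Push.
Variables (f : E -> nat) (sigma : V -> V).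

(** The residual network of a plan: one can always send one more unit along an
    edge of B, and take one back along an edge that carries some. *)
Definition residual : rel V := fun x y => match x, y with
  | inl i, inr k => (i, k) \in B
  | inr k, inl i => f (i, k) != 0
  | _, _ => false
  end.

Hypothesis inj : injective sigma.
Hypothesis arcs : forall x, sigma x != x -> residual x (sigma x).

Definition forward (e : E) : nat := (sigma (inl e.1) == inr e.2).
Definition backward (e : E) : nat := (sigma (inr e.2) == inl e.1).

(** The truncated subtraction is exact: a backward arc is only used where the
    plan is positive. *)
Definition push (e : E) : nat := (f e + forward e - backward e)%N.

Lemma pushE e : (push e + backward e = f e + forward e)%N.
Proof.
rewrite subnK // /backward; case: eqP => // E; apply: leq_trans (leq_addr _ _).
have := @arcs (inr e.2); rewrite E /= -surjective_pairing lt0n; exact.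
Qed.

(** No residual arc joins two vertices of the same side, so within a side sigma
    can only fix a vertex. *)
Lemma fixed_side (I : finType) (side : I -> V) i :
  injective side -> (forall i j, residual (side i) (side j) = false) ->
  (\sum_j (sigma (side i) == side j) = (sigma (side i) == side i))%N /\
  (\sum_j (sigma (side j) == side i) = (sigma (side i) == side i))%N.
Proof.
move=> side_inj no_arc.
have h i' j' : sigma (side i') == side j' -> i' = j'.
  move=> /eqP ij; apply/eqP; apply: contraT => ne.
  have := @arcs (side i'); rewrite ij (inj_eq side_inj) eq_sym ne no_arc.
  by move=> /(_ isT).
split; rewrite (bigD1 i) //= big1 ?addn0 // => j ji; case: eqP => // /eqP/h ij.
  by rewrite ij eqxx in ji.
by rewrite ij eqxx in ji.
Qed.

(** Every vertex that sigma moves is left by one arc and entered by one, and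
    both arcs join it to the other side. *)
Lemma push_margins : same_margins f push.
Proof.
split=> x.
  have [fixl fixr] := @fixed_side _ inl x (@inl_inj _ _) (fun _ _ => erefl).
  have bf : (\sum_k backward (x, k) = \sum_k forward (x, k))%N.
    have := sum_preimage_sides (inl x) inj; have := sum_indicator_sides (sigma (inl x)).
    rewrite fixr fixl => <- /addnI; exact.
  apply/eqP; rewrite -(eqn_add2r (\sum_k forward (x, k))) -{2}bf -!big_split /=.
  by apply/eqP/eq_bigr => k _; rewrite -pushE.
have [fixl fixr] := @fixed_side _ inr x (@inr_inj _ _) (fun _ _ => erefl).
have bf : (\sum_k backward (k, x) = \sum_k forward (k, x))%N.
  have := sum_preimage_sides (inr x) inj; have := sum_indicator_sides (sigma (inr x)).
  rewrite fixr fixl => <- /addIn; exact.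
apply/eqP; rewrite -(eqn_add2r (\sum_k forward (k, x))) -{2}bf -!big_split /=.
by apply/eqP/eq_bigr => k _; rewrite -pushE.
Qed.

Lemma push_support : edge_support f \subset B -> edge_support push \subset B.
Proof.
move=> /fintype.subsetP fB; apply/fintype.subsetP => e; rewrite inE.
have [f0|/negP nf] := eqVneq (f e) 0; last first.
  by move=> _; apply: fB; rewrite inE; apply/negP.
rewrite /push f0 add0n /forward; case: (sigma (inl _) =P _) => // E' _.
by have := @arcs (inl e.1); rewrite E' /= -surjective_pairing; exact.
Qed.

End Push.

Definition arc_cost (R : zmodType) (a : E -> R) (x y : V) : R := match x, y with
  | inl i, inr k => a (i, k)
  | inr k, inl i => - a (i, k)
  | _, _ => 0
  end.

Lemma push_cost (R : realDomainType) (a : E -> R) f sigma :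
  (forall x, sigma x != x -> residual f x (sigma x)) ->
  \sum_e a e * (push f sigma e)%:R =
  \sum_e a e * (f e)%:R + \sum_x arc_cost a x (sigma x).
Proof.
move=> arcs; rewrite big_sumType /=.
have -> : \sum_i arc_cost a (inl i) (sigma (inl i)) = \sum_e a e * (forward sigma e)%:R.
  rewrite sum_edges; apply: eq_bigr => i _; rewrite /forward /=.
  case: (sigma _) => [j|k]; first by rewrite big1 // => k _; rewrite mulr0.
  rewrite (bigD1 k) //= eqxx mulr1 big1 ?addr0 // => l /negPf lk.
  by rewrite (inj_eq (@inr_inj _ _)) eq_sym lk mulr0.
have -> : \sum_k arc_cost a (inr k) (sigma (inr k)) =
    - \sum_e a e * (backward sigma e)%:R.
  rewrite sum_edges exchange_big -sumrN; apply: eq_bigr => k _; rewrite /backward /=.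
  case: (sigma _) => [i|j]; last by rewrite big1 ?oppr0 // => i _; rewrite mulr0.
  rewrite (bigD1 i) //= eqxx mulr1 big1 ?addr0 // => l /negPf lk.
  by rewrite (inj_eq (@inl_inj _ _)) eq_sym lk mulr0.
rewrite addrA; apply/eqP; rewrite -subr_eq opprK -!big_split /=; apply/eqP.
by apply: eq_bigr => e _; rewrite -!mulrDr -!natrD pushE.
Qed.

Definition feasible (f g : E -> nat) : Prop :=
  edge_support g \subset B /\ same_margins f g.

(** Linear programming duality for transport plans: by optimality the residual
    network has no negative cycle, and its potentials, up to sign, are the
    dual solution. *)
Lemma optimal_potentials (R : realDomainType) (a : E -> R) (f : E -> nat) :
  edge_support f \subset B ->
  (forall g, feasible f g -> \sum_e a e * (f e)%:R <= \sum_e a e * (g e)%:R) ->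
  exists (p : 'I_d -> R) (w : 'I_n -> R), forall i k, (i, k) \in B ->
    p i - a (i, k) <= w k /\ (f (i, k) != 0 -> p i - a (i, k) = w k).
Proof.
move=> fB fopt.
have [|sigma inj arcs|u uP] := @exists_potential R V (residual f) (arc_cost a).
- by case.
- rewrite -(lerD2l (\sum_e a e * (f e)%:R)) addr0 -push_cost //.
  by apply: fopt; split; [exact: push_support|exact: push_margins].
exists (fun i => - u (inl i)), (fun k => - u (inr k)) => i k ik.
have h1 := uP (inl i) (inr k) ik; rewrite /= in h1.
split=> [|fik]; first by lra.
have := uP (inr k) (inl i) fik; rewrite /=; lra.
Qed.

End Transport.

(** * Affine independence of tight edges *)

Section Genericity.
Variables (R : realType) (d n : nat).
Local Notation E := ('I_d * 'I_n)%type.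
Implicit Types (e : E) (x : 'rV[R]_(d + n)).

Lemma root_vertexE e j : root_vertex R e 0 j =
  (j == lshift n e.1)%:R - (j == rshift d e.2)%:R.
Proof. by rewrite /root_vertex !mxE !eqxx. Qed.

Lemma root_vertex_dot (u : 'rV[R]_(d + n)) e :
  \sum_j u 0 j * root_vertex R e 0 j = u 0 (lshift n e.1) - u 0 (rshift d e.2).
Proof.
have ev j0 : \sum_j u 0 j * (j == j0)%:R = u 0 j0.
  rewrite (bigD1 j0) //= eqxx mulr1 big1 ?addr0 // => j /negPf ->.
  by rewrite mulr0.
by under eq_bigr do rewrite root_vertexE mulrBr; rewrite sumrB !ev.
Qed.

(** On the root polytope this functional is maximal, with value 2, at the vertex
    of e only; it witnesses that each root vertex is extreme. *)
Definition edge_height e x : R := x 0 (lshift n e.1) - x 0 (rshift d e.2).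

Lemma edge_height_sum e (I : finType) (P : pred I) (c : I -> R) v :
  edge_height e (\sum_(i | P i) c i *: v i) = \sum_(i | P i) c i * edge_height e (v i).
Proof.
rewrite /edge_height !summxE -sumrB; apply: eq_bigr => i _.
by rewrite !mxE mulrBr.
Qed.

Lemma edge_height_root e e' :
  edge_height e (root_vertex R e') = (e.1 == e'.1)%:R + (e.2 == e'.2)%:R.
Proof.
rewrite /edge_height !root_vertexE eq_lshift eq_rshift eq_lrshift eq_rlshift.
by rewrite subr0 sub0r opprK.
Qed.

Lemma edge_height_lt2 e e' : e' != e -> edge_height e (root_vertex R e') < 2.
Proof.
rewrite edge_height_root => ne; rewrite -natrD ltr_nat.
case: eqP => [e1|_]; case: eqP => [e2|_] //; case/eqP: ne.
by apply/esym; rewrite [LHS]surjective_pairing e1 e2 -surjective_pairing.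
Qed.

Lemma edge_height_le2 e e' : edge_height e (root_vertex R e') <= 2.
Proof.
rewrite edge_height_root -natrD ler_nat; by do 2 case: (_ == _).
Qed.

Lemma root_vertex_extreme (B : {set E}) e x :
  convex_hull B (@root_vertex R d n) x ->
  edge_height e x <= 2 /\ (edge_height e x = 2 -> x = root_vertex R e).
Proof.
move=> [c [c0 c1 ->]].
have E2 : 2 - edge_height e (\sum_(i in B) c i *: root_vertex R i) =
    \sum_(i in B) c i * (2 - edge_height e (root_vertex R i)).
  rewrite edge_height_sum; under [RHS]eq_bigr do rewrite mulrBr.
  by rewrite sumrB -mulr_suml c1 mul1r.
have t0 i : i \in B -> 0 <= c i * (2 - edge_height e (root_vertex R i)).
  by move=> iB; rewrite mulr_ge0 ?c0 // subr_ge0 edge_height_le2.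
split=> [|h]; first by rewrite -subr_ge0 E2 sumr_ge0.
have z := esym E2; rewrite h subrr in z.
have cz i : i \in B -> i != e -> c i = 0.
  move=> iB ie; have /eqP := psumr_eq0P t0 z iB.
  by rewrite mulf_eq0 subr_eq0 [2 == _]gt_eqF ?edge_height_lt2 // orbF => /eqP.
have eB : e \in B.
  apply: contra_eqT c1 => eB; rewrite big1 ?[0 == _]eq_sym ?oner_eq0 // => i iB.
  by apply: cz => //; apply: contraNneq eB => <-.
have ce : c e = 1.
  rewrite -c1 (bigD1 e) //= big1 ?addr0 // => i /andP[iB ie]; exact: cz.
rewrite (bigD1 e) //= ce scale1r big1 ?addr0 // => i /andP[iB ie].
by rewrite cz // scale0r.
Qed.

Variable A : 'M[\bar R]_(d, n).
Let B := support_graph A.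
Let a e : R := fine (A e.1 e.2).

(** The potentials define a lower face of the lifted root polytope that contains
    all tight edges.  By genericity its projection is a simplex; since root
    vertices are extreme points of the root polytope, those of the tight edges
    are vertices of this simplex, hence affinely independent. *)
Lemma generic_independent (p : 'I_d -> R) (w : 'I_n -> R) (g : E -> R) :
  sufficiently_generic A ->
  (forall e, e \in B -> p e.1 - a e <= w e.2) ->
  (forall e, g e != 0 -> e \in B /\ p e.1 - a e = w e.2) ->
  (forall i, \sum_k g (i, k) = 0) -> (forall k, \sum_i g (i, k) = 0) ->
  forall e, g e = 0.
Proof.
move=> gen pw tight gr gc.
(* With these coefficients the height of the lifted vertex of an edge is its
   slack a_ik - p_i + w_k. *)
pose u : 'rV[R]_(d + n) := row_mx (\row_i - p i) (\row_k - w k).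
pose L (x : 'rV[R]_(d + n) * R^o) := \sum_j u 0 j * x.1 0 j + x.2.
pose ve e : 'rV[R]_(d + n) * R^o := (root_vertex R e, (a e : R^o)).
have Lve e : L (ve e) = a e - p e.1 + w e.2.
  rewrite /L /= root_vertex_dot /u row_mxEl row_mxEr !mxE; lra.
pose F : set ('rV[R]_(d + n) * R^o) :=
  [set x | lifted_polytope A x /\ forall y, lifted_polytope A y -> L x <= L y]%classic.
have sum1 (c : E -> R) :
    (\sum_(e in B) c e *: ve e).1 = \sum_(e in B) c e *: root_vertex R e.
  exact: (big_morph fst (fun _ _ => erefl) erefl).
have sum2 (c : E -> R) :
    (\sum_(e in B) c e *: ve e).2 = \sum_(e in B) c e * a e.
  exact: (big_morph snd (fun _ _ => erefl) erefl).
have L_ge0 y : lifted_polytope A y -> 0 <= L y.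
  move=> [c [c0 _ ->]]; rewrite /L -/ve.
  have -> : \sum_j u 0 j * (\sum_(e in B) c e *: ve e).1 0 j +
     (\sum_(e in B) c e *: ve e).2 = \sum_(e in B) c e * L (ve e).
    rewrite sum1 sum2 /L; under [RHS]eq_bigr do rewrite mulrDr.
    rewrite big_split /=; congr (_ + _).
    under eq_bigr do rewrite summxE mulr_sumr.
    rewrite exchange_big; apply: eq_bigr => e _; rewrite mulr_sumr.
    by apply: eq_bigr => j _; rewrite [RHS]mulrCA; congr (_ * _); rewrite mxE.
  apply: sumr_ge0 => e eB; rewrite mulr_ge0 ?c0 // Lve.
  by have := pw e eB; lra.
have tightF e : g e != 0 -> F (ve e).
  move=> /tight[eB te]; split=> [|y Py].
    exists (fun e' => (e' == e)%:R); split => [e' _||].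
    - by rewrite ler0n.
    - rewrite (bigD1 e) //= eqxx big1 ?addr0 // => e' /andP[_ /negPf ->] //.
    - rewrite (bigD1 e) //= eqxx scale1r big1 ?addr0 // => e' /andP[_ /negPf ->].
      by rewrite scale0r.
  apply: le_trans (L_ge0 y Py); rewrite Lve -te; lra.
have FC : regular_subdivision A (fst @` F)%classic.
  by exists F => //; exists u.
have [k [q [qind Fq]]] := gen _ FC.
have CB x : (fst @` F)%classic x -> convex_hull B (@root_vertex R d n) x.
  by move=> [y [[c [c0 c1 ->]] _] <-]; exists c; split => //; rewrite -/ve sum1.
have qC j : convex_hull B (@root_vertex R d n) (q j).
  apply: CB; rewrite Fq; exists (fun i => (i == j)%:R); split => [i _||].
  - by rewrite ler0n.
  - by rewrite (bigD1 j) ?inE //= eqxx big1 ?addr0 // => i /andP[_ /negPf ->].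
  - rewrite (bigD1 j) ?inE //= eqxx scale1r big1 ?addr0 // => i /andP[_ /negPf ->].
    by rewrite scale0r.
(* An extreme point of the convex hull of the q j is one of them: every q j
   with a positive coefficient maximizes [edge_height e]. *)
have vq e : g e != 0 -> exists j, q j = root_vertex R e.
  move=> ge; have : (fst @` F)%classic (root_vertex R e).
    by exists (ve e) => //; exact: tightF.
  rewrite Fq => -[c [c0 c1 vE]].
  have h0 : edge_height e (root_vertex R e) = 2.
    by rewrite edge_height_root !eqxx -natrD.
  have z : \sum_(j in [set: 'I_k]%SET) c j * (2 - edge_height e (q j)) = 0.
    under eq_bigr do rewrite mulrBr.
    by rewrite sumrB -mulr_suml c1 mul1r -edge_height_sum -vE h0 subrr.
  have /existsP[j cj] : [exists j, c j != 0].
    apply: contra_eqT c1; rewrite negb_exists => /forallP c00.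
    rewrite big1 ?[0 == _]eq_sym ?oner_eq0 // => j _.
    by apply/eqP; rewrite -[_ == _]negbK.
  exists j; apply: (root_vertex_extreme e (qC j)).2.
  have t0 i : i \in [set: 'I_k]%SET -> 0 <= c i * (2 - edge_height e (q i)).
    move=> iT; rewrite mulr_ge0 ?c0 // subr_ge0.
    by case: (root_vertex_extreme e (qC i)).
  have /eqP := psumr_eq0P t0 z (finset.in_setT j).
  by rewrite mulf_eq0 (negPf cj) /= subr_eq0 => /eqP.
move=> e; apply/eqP/negPn/negP => ge.
have [k0 _] := vq e ge.
pose J e' := odflt k0 [pick j | q j == root_vertex R e'].
have qJ e' : g e' != 0 -> q (J e') = root_vertex R e'.
  move=> /vq[j jE]; rewrite /J; case: pickP => [i /eqP //|/(_ j)].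
  by rewrite jE eqxx.
pose c j := \sum_(e' | J e' == j) g e'.
have c0 : forall j, c j = 0.
  apply: qind.
    transitivity (\sum_e' g e'); first by rewrite [RHS](partition_big J xpredT).
    by rewrite sum_edges big1.
  have -> : \sum_i c i *: q i = \sum_e' g e' *: root_vertex R e'.
    rewrite [RHS](partition_big J xpredT) //=; apply: eq_bigr => j _.
    rewrite scaler_suml; apply: eq_bigr => e' /eqP <-.
    have [->|/qJ ->] // := eqVneq (g e') 0; by rewrite !scale0r.
  rewrite sum_edges; under eq_bigr do under eq_bigr do rewrite scalerBr /=.
  under eq_bigr do rewrite sumrB -scaler_suml gr scale0r sub0r.
  rewrite sumrN exchange_big /= big1 ?oppr0 // => l _.
  by rewrite -scaler_suml gc scale0r.
have := c0 (J e); rewrite /c (bigD1 e) //= big1 ?addr0 => [/eqP|e' /andP[/eqP Je ne]].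
  by rewrite (negPf ge).
apply/eqP/negPn/negP => ge'; have := edge_height_lt2 ne.
by rewrite -(qJ _ ge') Je (qJ _ ge) edge_height_root !eqxx -natrD ltxx.
Qed.

End Genericity.

(** * Strict complementarity for generic costs *)

Lemma positive_lower_bound (R : realDomainType) (T : finType) (P : T -> Prop)
    (h : T -> R) : (forall t, P t -> 0 < h t) ->
  exists2 delta, 0 < delta & forall t, P t -> delta <= h t.
Proof.
move=> hP; case: (pickP (fun t => `[< P t >])) => [t0 Pt0|none]; last first.
  by exists 1 => // t Pt; have := none t; rewrite asboolT.
case: (@Order.TotalTheory.arg_minP _ _ _ t0 (fun t => `[< P t >]) h Pt0) =>
  t /asboolP Pt tmin.
by exists (h t) => [|t' /asboolP /tmin //]; exact: hP.
Qed.

Section Plans.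
Variables (R : realType) (d n : nat).
Local Notation E := ('I_d * 'I_n)%type.
Variables (B : {set E}) (o : E -> nat).

Lemma feasible_sum g : feasible B o g -> (\sum_e g e = \sum_e o e)%N.
Proof. by case=> _ [gr _]; rewrite !sum_edges; apply: eq_bigr => i _. Qed.

Definition plan_code : finType := {ffun E -> 'I_(\sum_e o e).+1}.
Definition decode (t : plan_code) e : nat := t e.

(** An entry of a plan is at most its mass, so there are finitely many plans
    with given margins. *)
Lemma feasible_code g : feasible B o g -> exists t, g = decode t.
Proof.
move=> /feasible_sum s; exists [ffun e => inord (g e)].
by apply/funext => e; rewrite /decode ffunE inordK // ltnS -s (bigD1 e) //= leq_addr.
Qed.

Definition plan_cost (a : E -> R) (g : E -> nat) : R := \sum_e a e * (g e)%:R.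

Lemma exists_optimal (a : E -> R) : edge_support o \subset B ->
  exists2 f, feasible B o f & forall g, feasible B o g -> plan_cost a f <= plan_cost a g.
Proof.
move=> oB; have oo : feasible B o o by split.
have [t0 t0E] := feasible_code oo.
pose P t := `[< feasible B o (decode t) >].
have Pt0 : P t0 by apply/asboolP; rewrite -t0E.
case: (@Order.TotalTheory.arg_minP _ _ _ t0 P
  (fun t => plan_cost a (decode t)) Pt0) => t /asboolP Pt tmin.
exists (decode t) => // g og; have [t' gE] := feasible_code og.
by rewrite gE; apply: tmin; apply/asboolP; rewrite -gE.
Qed.

Lemma exists_gap (a : E -> R) f :
  (forall g, feasible B o g -> g <> f -> plan_cost a f < plan_cost a g) ->
  exists2 delta, 0 < delta &
    forall g, feasible B o g -> g <> f -> plan_cost a f + delta <= plan_cost a g.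
Proof.
move=> gap.
have [t [tf tg]|delta d0 dP] := @positive_lower_bound R plan_code
  (fun t => feasible B o (decode t) /\ decode t <> f)
  (fun t => plan_cost a (decode t) - plan_cost a f).
  by rewrite subr_gt0; exact: gap.
exists delta => // g og gf; have [t gE] := feasible_code og.
by have := dP t; rewrite -gE lerBrDl; exact.
Qed.

End Plans.

Section Complementarity.
Variables (R : realType) (d n : nat).
Local Notation E := ('I_d * 'I_n)%type.

Lemma feasible_trans (B : {set E}) (o f g : E -> nat) :
  feasible B o f -> feasible B f g -> feasible B o g.
Proof.
move=> [_ [fr fc]] [gB [gr gc]]; split=> //.
by split=> i; rewrite ?fr ?fc ?gr ?gc.
Qed.

Lemma natr_margins (W : pzRingType) (f g : E -> nat) : same_margins f g ->
  same_margins (fun e => (f e)%:R : W) (fun e => (g e)%:R : W).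
Proof. by case=> fr fc; split=> i; rewrite -!natr_sum ?fr ?fc. Qed.

Lemma edge_support_natr (f : E -> nat) :
  edge_support (fun e => (f e)%:R : R) = edge_support f.
Proof. by apply/setP => e; rewrite !inE pnatr_eq0. Qed.

Variable A : 'M[\bar R]_(d, n).
Let B := support_graph A.
Let a (e : E) : R := fine (A e.1 e.2).

(** By complementary slackness both optimal plans live on the edges that are
    tight for the potentials of f, where their difference has zero margins. *)
Lemma generic_optimum_unique (o f g : E -> nat) : sufficiently_generic A ->
  feasible B o f -> (forall g, feasible B o g -> plan_cost a f <= plan_cost a g) ->
  feasible B o g -> plan_cost a g <= plan_cost a f -> g = f.
Proof.
move=> gen fF fopt gF gle.
have [g' g'F|p [w pw]] := @optimal_potentials _ _ B R a f fF.1.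
  by apply: fopt; exact: feasible_trans g'F.
pose s e := a e - p e.1 + w e.2.
have s_ge0 e : e \in B -> 0 <= s e.
  by case: e => i k ik; have [+ _] := pw _ _ ik; rewrite /s /=; lra.
have margE : \sum_e (g e)%:R * (- p e.1 + w e.2) = \sum_e (f e)%:R * (- p e.1 + w e.2).
  apply: (same_margins_sum (fun i => - p i) w); apply: natr_margins.
  by case: gF.2 fF.2 => gr gc [fr fc]; split=> i; rewrite -?gr -?gc.
have sE (h : E -> nat) : \sum_e (h e)%:R * s e =
    plan_cost a h + \sum_e (h e)%:R * (- p e.1 + w e.2).
  by rewrite -big_split; apply: eq_bigr => e _; rewrite /= /s; ring.
have sf e : (f e)%:R * s e = 0.
  have [->|nz] := eqVneq (f e) 0; first by rewrite mul0r.
  have eB : (e.1, e.2) \in B.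
    by rewrite -surjective_pairing (fintype.subsetP fF.1) // inE.
  have [_ ] := pw _ _ eB; rewrite -surjective_pairing => /(_ nz) E0.
  by rewrite /s -E0 [X in _ * X](_ : _ = 0) ?mulr0 //; ring.
have sg_ge0 e : xpredT e -> 0 <= (g e)%:R * s e.
  move=> _; have [->|nz] := eqVneq (g e) 0; first by rewrite mul0r.
  by rewrite mulr_ge0 ?s_ge0 // (fintype.subsetP gF.1) // inE.
have sg : \sum_e (g e)%:R * s e = 0.
  apply/eqP; rewrite eq_le sumr_ge0 // andbT sE margE.
  have := sE f; rewrite big1 // => h; lra.
have sg0 e : (g e)%:R * s e = 0 := psumr_eq0P sg_ge0 sg isT.
have h0 := @generic_independent R d n A p w (fun e => (g e)%:R - (f e)%:R) gen.
apply/funext => e; apply/eqP; rewrite -(eqr_nat R) -subr_eq0; apply/eqP.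
apply: h0 => [[i k] ik|e' nz|i|k]; first by have [] := pw _ _ ik.
- have [f0|fnz] := eqVneq (f e') 0; last first.
    have eB : e' \in B by rewrite (fintype.subsetP fF.1) // inE.
    split=> //; have /eqP := sf e'; rewrite mulf_eq0 pnatr_eq0 (negPf fnz) /= /s => /eqP.
    rewrite /a; lra.
  rewrite f0 subr0 pnatr_eq0 in nz.
  have eB : e' \in B by rewrite (fintype.subsetP gF.1) // inE.
  split=> //; have /eqP := sg0 e'; rewrite mulf_eq0 pnatr_eq0 (negPf nz) /= /s => /eqP.
  rewrite /a; lra.
- by rewrite sumrB -!natr_sum -(gF.2.1 i) (fF.2.1 i) subrr.
- by rewrite sumrB -!natr_sum -(gF.2.2 k) (fF.2.2 k) subrr.
Qed.

(** As f is the unique optimal plan, every other plan costs at least delta more.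
    All plans have the same mass N, so lowering the costs by eps with
    eps N <= delta outside supp f keeps f optimal; potentials for the lowered
    costs have slack at least eps outside supp f. *)
Lemma strict_complementarity (o : E -> nat) : sufficiently_generic A ->
  edge_support o \subset B ->
  exists f (p : 'I_d -> R) (w : 'I_n -> R), feasible B o f /\
    forall i k, (i, k) \in B ->
      p i - a (i, k) <= w k /\ (f (i, k) != 0 <-> p i - a (i, k) = w k).
Proof.
move=> gen oB; have [f fF fopt] := exists_optimal a oB; exists f.
have [g gF gf|delta d0 gap] := @exists_gap R d n B o a f.
  rewrite ltNge; apply/negP => gle; apply: gf.
  exact: (generic_optimum_unique gen fF fopt gF gle).
pose N : R := (\sum_e o e)%N%:R; pose eps := delta / (N + 1).
have N0 : 0 <= N by rewrite ler0n.
have eps0 : 0 < eps by rewrite divr_gt0 // ltr_pwDr.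
have epsN : eps * N <= delta.
  by rewrite /eps mulrAC ler_pdivrMr ?ltr_pwDr // ler_pM2l // lerDl.
pose a' e := a e - (if f e == 0 then eps else 0).
have [g gF|p [w pw]] := @optimal_potentials _ _ B R a' f fF.1.
- have a'f : \sum_e a' e * (f e)%:R = plan_cost a f.
    apply: eq_bigr => e _; rewrite /a'; case: eqP => [->|_]; last by rewrite subr0.
    by rewrite !mulr0.
  rewrite a'f; have gF' := feasible_trans fF gF.
  have [->|gf] := pselect (g = f); first by rewrite a'f.
  apply: (@le_trans _ _ (plan_cost a g - eps * N)).
    have := gap g gF' gf; lra.
  rewrite /N -(feasible_sum gF') natr_sum mulr_sumr -sumrB.
  apply: ler_sum => e _; rewrite /a' mulrBl lerD2l lerN2.
  by case: ifP => // _; rewrite mul0r mulr_ge0 // ltW.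
exists p, w; split => // i k ik; have [h1 h2] := pw _ _ ik.
rewrite /a' in h1 h2; have [f0|nz] := eqVneq (f (i, k)) 0.
  rewrite f0 eqxx in h1; split; first by lra.
  split=> // h; have := h1; have := eps0; lra.
rewrite (negPf nz) subr0 in h1 h2; split=> //; split=> // _; exact: h2.
Qed.

End Complementarity.

(** * Boundedness and dimension modulo the all-ones line *)

Section TorusBounded.
Variables (R : realType) (d : nat).

Lemma norm_entry (y : 'rV[R]_d) i : `|y 0 i| <= `|y|.
Proof.
rewrite [leRHS]/Num.Def.normr/= mx_normrE.
exact: (le_bigmax _ (fun ij => `|y ij.1 ij.2|) (0, i)).
Qed.

Lemma norm_le_entries (y : 'rV[R]_d) M : 0 <= M -> (forall i, `|y 0 i| <= M) -> `|y| <= M.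
Proof.
move=> M0 yM; rewrite [leLHS]/Num.Def.normr/= mx_normrE.
by apply: bigmax_le => // -[i j] _; rewrite ord1.
Qed.

Lemma torus_boundedP (X : set 'rV[R]_d) (i0 : 'I_d) :
  torus_bounded X <-> exists M, forall p, X p -> forall i j, p 0 i - p 0 j <= M.
Proof.
split=> [[Y Yb XY]|[M XM]].
  have [[y0 Yy0]|nY] := pselect (exists y, Y y); last first.
    by exists 0 => p /XY[y Yy]; case: nY; exists y.
  have [M YM] := (ex_bound (fun x => x) (PF := globally_properfilter Yy0)).1 Yb.
  exists (M + M) => p /XY[y Yy [t pyt]] i j.
  have e k : p 0 k = y 0 k + t.
    by have /rowP/(_ k) := pyt; rewrite !mxE mulr1; lra.
  rewrite !e; have := YM _ Yy => /= nM.
  have := le_trans (norm_entry y i) nM; have := le_trans (norm_entry y j) nM.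
  by rewrite !ler_norml; lra.
pose Y : set 'rV[R]_d := [set y | `|y| <= `|M|]%classic.
exists Y => [|p Xp].
  have Y0 : Y 0 by rewrite /Y /= normr0.
  apply: (ex_bound (fun x => x) (PF := globally_properfilter Y0)).2.
  by exists `|M|.
exists (p - (p 0 i0) *: const_mx 1).
  apply: norm_le_entries => // i; rewrite !mxE mulr1.
  apply: le_trans (ler_norm M); rewrite ler_norml.
  have := XM p Xp i i0; have := XM p Xp i0 i; lra.
by exists (p 0 i0); rewrite opprB addrC subrK.
Qed.

Definition has_independent (X : set 'rV[R]_d) k : Prop :=
  exists q : 'I_k -> 'rV[R]_d,
    (forall i, X (q i)) /\ affinely_independent_mod (@all_ones_line R d) q.

(** The maximum in [torus_dim] is attained because the empty family is
    independent. *)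
Lemma torus_dimP (X : set 'rV[R]_d) : exists m : nat,
  [/\ (m <= d)%N, torus_dim X = m%:Z - 1, has_independent X m &
     forall k, (k <= d)%N -> has_independent X k -> (k <= m)%N].
Proof.
pose P (k : 'I_d.+1) := `[< has_independent X k >].
have P0 : P ord0.
  by apply/asboolP; exists (fun _ => 0); split=> [[]//|c _ _ []].
have [|m Pm mE] := @eq_bigmax_cond _ P (fun k => k : nat).
  by apply/card_gt0P; exists ord0.
exists m; split.
- by rewrite -ltnS.
- by rewrite /torus_dim -mE.
- exact/asboolP.
- move=> k kd Xk; rewrite -mE.
  have kd' : (k < d.+1)%N by rewrite ltnS.
  apply: (leq_bigmax_cond (P := P) (F := fun k => k : nat) (Ordinal kd')).
  by apply/asboolP.
Qed.

End TorusBounded.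

(** * Cells of the tropical complex *)

Section Cells.
Variables (R : realType) (d n : nat) (A : 'M[\bar R]_(d, n)).
Hypothesis hA : tropical_matrix A.
Local Notation E := ('I_d * 'I_n)%type.
Implicit Types (p q : 'rV[R]_d).
Let B := support_graph A.
Let a (e : E) : R := fine (A e.1 e.2).

Definition type_graph p : {set E} := [set e | fine_type A p e.1 e.2]%SET.

Lemma in_type_graph p i k : (i, k) \in type_graph p <->
  (i, k) \in B /\ forall j, (j, k) \in B -> p 0 j - a (j, k) <= p 0 i - a (i, k).
Proof.
rewrite inE /= mxE !inE /=; have [fi|_] /= := boolP (A i k \is a fin_num); last first.
  by split=> // -[].
rewrite /in_sector; split=> [/forallP h|[_ h]].
  split=> // j; rewrite inE /= => fj; have := h j; rewrite /a /=.
  by rewrite -{1}(fineK fi) -{1}(fineK fj) -!EFinB lee_fin.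
apply/forallP => j; have [fj|nfj] := boolP (A j k \is a fin_num).
  have := h j; rewrite inE /= => /(_ fj); rewrite /a /=.
  by rewrite -{2}(fineK fi) -{2}(fineK fj) -!EFinB lee_fin.
move: nfj (hA.1 j k); rewrite fin_numE negb_and !negbK => /orP[-> //|/eqP -> _].
by rewrite -(fineK fi) leNye.
Qed.

Lemma type_graph_sub p : type_graph p \subset B.
Proof. by apply/fintype.subsetP => -[i k] /in_type_graph[]. Qed.

Lemma exists_sector p k : exists i, (i, k) \in type_graph p.
Proof.
have [i0 i0k] := hA.2 k.
case: (@Order.TotalTheory.arg_maxP _ _ _ i0 (fun i => (i, k) \in B)
  (fun i => p 0 i - a (i, k))); first by rewrite inE.
by move=> i ik imax; exists i; apply/in_type_graph.
Qed.

Lemma cellE p q : cell A (fine_type A p) q <->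
  forall i j k, (i, k) \in type_graph p -> (j, k) \in B ->
    q 0 j - a (j, k) <= q 0 i - a (i, k).
Proof.
split=> [h i j k ik jk|h i k ik].
  have : (i, k) \in type_graph q by rewrite inE /=; apply: h; rewrite inE in ik.
  by move/in_type_graph => -[_]; apply.
suff : (i, k) \in type_graph q by rewrite inE.
have ik' : (i, k) \in type_graph p by rewrite inE.
apply/in_type_graph; split; first exact: (fintype.subsetP (type_graph_sub p)).
by move=> j; apply: h.
Qed.

Lemma cell_self p : cell A (fine_type A p) p.
Proof. by []. Qed.

(** A chosen sector of the k-th hyperplane that contains p; it lets functions on
    left nodes be extended to right nodes. *)
Definition sector_of p k : 'I_d := projT1 (cid (exists_sector p k)).

Lemma sector_ofP p k : (sector_of p k, k) \in type_graph p.
Proof. exact: projT2 (cid (exists_sector p k)). Qed.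

(** The value at a right node of the tropical linear form defining the k-th
    hyperplane; along T(p) it does not depend on the chosen sector. *)
Lemma cell_tight p q i k : cell A (fine_type A p) q -> (i, k) \in type_graph p ->
  q 0 i - a (i, k) = q 0 (sector_of p k) - a (sector_of p k, k).
Proof.
move=> /cellE h ik; have TB := fintype.subsetP (type_graph_sub p).
by apply/eqP; rewrite eq_le !h ?sector_ofP ?TB ?sector_ofP.
Qed.

(** The vectors q_c - p are constant on the components of T(p).  Normalising
    them to take the value 1 at i0 makes an affine dependency modulo the
    all-ones line the same as a linear dependency. *)
Lemma independent_le_components p k (i0 : 'I_d) :
  has_independent (cell A (fine_type A p)) k ->
  (k <= num_components (type_graph p))%N.
Proof.
move=> [q [qC qind]]; rewrite leqNgt; apply/negP => lt.
pose y c i : R := q c 0 i - p 0 i - (q c 0 i0 - p 0 i0) + 1.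
pose r (c : 'I_k) (x : 'I_d + 'I_n) : R := match x with
  | inl i => y c i | inr l => y c (sector_of p l) end.
have [c i l il||g [j nz] g0] := @dependent_on_components R d n (type_graph p) 'I_k r.
- have := cell_tight (qC c) il; have := cell_tight (@cell_self p) il.
  rewrite /r /y; lra.
- by rewrite card_ord.
have sg : \sum_c g c = 0.
  have := g0 (inl i0); rewrite /r /y /=.
  by under eq_bigr do rewrite subrr add0r mulr1.
case/eqP: nz; apply: qind => //.
exists (\sum_c g c * q c 0 i0); apply/rowP => i.
rewrite summxE !mxE mulr1; apply/eqP; rewrite -subr_eq0 -sumrB; apply/eqP.
have rE : \sum_c g c * r c (inl i) = \sum_c (g c * q c 0 i - g c * q c 0 i0)
    + (\sum_c g c) * (1 - p 0 i + p 0 i0).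
  rewrite mulr_suml -big_split; apply: eq_bigr => c _.
  by rewrite /= /y; ring.
rewrite -[RHS](g0 (inl i)) rE sg mul0r addr0.
by apply: eq_bigr => c _; rewrite mxE.
Qed.

(** Every right node has a neighbour in T(p), so no component consists of right
    nodes only. *)
Lemma component_left p (j : components (type_graph p)) :
  exists i, component_of (type_graph p) (inl i) = j.
Proof.
have [x xj] : exists x, component_of (type_graph p) x = j.
  by exists (val j); apply: val_inj; apply/eqP; exact: (valP j).
case: x xj => [i ij|k kj]; first by exists i.
exists (sector_of p k); rewrite -kj; apply: val_inj.
by apply: component_root_edge; exact: sector_ofP.
Qed.

Lemma num_components_type_graph p : (num_components (type_graph p) <= d)%N.
Proof.
pose f (j : components (type_graph p)) : 'I_d := projT1 (cid (component_left j)).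
have fK : cancel f (fun i => component_of (type_graph p) (inl i)).
  by move=> j; exact: projT2 (cid (component_left j)).
by rewrite -card_components -[X in (_ <= X)%N]card_ord; exact: leq_card (can_inj fK).
Qed.

(** The points p + eps 1_C, for C ranging over the components of T(p), lie in
    the cell when eps is at most the slack of every inequality that is
    strict at p. *)
Lemma cell_independent p :
  has_independent (cell A (fine_type A p)) (num_components (type_graph p)).
Proof.
rewrite -card_components; set T := type_graph p.
have [[[i j] k] /= [ik jk njk]|eps eps0 slack] :=
  @positive_lower_bound R ('I_d * 'I_d * 'I_n)%type
    (fun t => [/\ (t.1.1, t.2) \in T, (t.1.2, t.2) \in B & (t.1.2, t.2) \notin T])
    (fun t => (p 0 t.1.1 - a (t.1.1, t.2)) - (p 0 t.1.2 - a (t.1.2, t.2))).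
  rewrite subr_gt0 ltNge; apply: contra njk => le.
  apply/in_type_graph; split => // l lk; apply: le_trans le.
  by case/in_type_graph: ik => _; apply.
pose ind (j : components T) i : R := (component_of T (inl i) == j)%:R.
pose q (j : components T) : 'rV[R]_d := \row_i (p 0 i + eps * ind j i).
have qE j i : q j 0 i = p 0 i + eps * ind j i by rewrite mxE.
exists (fun j => q (enum_val j)); split=> [j|c sc [t ct] j].
  apply/cellE => i l k ik lk; rewrite !qE.
  have [lkT|nlk] := boolP ((l, k) \in T).
    have il : component_of T (inl i) = component_of T (inl l).
      by apply: val_inj; rewrite /= (component_root_edge ik) (component_root_edge lkT).
    have := cell_tight (@cell_self p) ik; have := cell_tight (@cell_self p) lkT.
    rewrite /ind il; lra.
  have /= := slack (i, l, k) (And3 ik lk nlk).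
  have le1 : eps * ind (enum_val j) l <= eps.
    by rewrite ler_piMr ?(ltW eps0) // /ind lern1 leq_b1.
  have ge0 : 0 <= eps * ind (enum_val j) i by rewrite mulr_ge0 ?(ltW eps0) ?ler0n.
  lra.
have cE j' : eps * c j' = t.
  have [i ij] := component_left (enum_val j').
  have /rowP/(_ i) := ct; rewrite summxE !mxE mulr1 => <-.
  under eq_bigr do rewrite mxE qE mulrDr.
  rewrite big_split /= -mulr_suml sc mul0r add0r (bigD1 j') //= big1 ?addr0.
    by rewrite /ind ij eqxx mulr1 mulrC.
  move=> l lj; rewrite /ind ij (inj_eq enum_val_inj) eq_sym (negPf lj).
  by rewrite !mulr0.
have t0 : t *+ #|components T| = 0.
  rewrite -[RHS](mulr0 eps) -sc mulr_sumr.
  by under eq_bigr do rewrite cE; rewrite sumr_const card_ord.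
have := cE j; move/eqP: t0; rewrite mulrn_eq0.
have -> : (#|components T| == 0)%N = false.
  by apply/negbTE; rewrite -lt0n; apply: leq_ltn_trans (ltn_ord j).
move=> /= /eqP -> /eqP; rewrite mulf_eq0 gt_eqF //= => /eqP; exact.
Qed.

(** For (i, k) in T(p) and (j, k) in B the cell satisfies
    q_j - q_i <= a_jk - a_ik, and j -> k -> i is a path of R(T(p); B).  So a
    path bounds the difference of coordinates of its ends.  Conversely, raising
    the coordinates of all nodes reachable from x by the same amount never
    leaves the cell. *)
Lemma bounded_strongly_connected p (i0 : 'I_d) :
  torus_bounded (cell A (fine_type A p)) <->
  strongly_connected (recession_graph (type_graph p) B).
Proof.
have TB := type_graph_sub p.
split=> [/(torus_boundedP _ i0)[M XM]|/strongly_connectedP sc].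
  apply/strongly_connectedP => x y; apply: contraT => nxy; exfalso.
  pose U := connect (recession_graph (type_graph p) B) x.
  have Ucl z t : recession_graph (type_graph p) B z t -> U z -> U t.
    by move=> zt xz; exact: connect_trans xz (connect1 zt).
  have UB i k : (i, k) \in B -> U (inl i) -> U (inr k).
    by move=> ik; apply: Ucl; rewrite recession_arc.
  have UT i k : (i, k) \in type_graph p -> U (inr k) -> U (inl i).
    by move=> ik; exact: Ucl.
  have [i iU] : exists i, U (inl i).
    case: x @U {nxy Ucl} UB UT => [i|k] U UB UT; first by exists i; exact: connect0.
    by exists (sector_of p k); apply: UT (sector_ofP p k) _; exact: connect0.
  have [j jU] : exists j, ~~ U (inl j).
    case: y nxy => [j|k] nU; first by exists j.
    exists (sector_of p k); apply: contra nU; apply: UB.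
    exact: (fintype.subsetP TB) (sector_ofP p k).
  pose v i : R := (U (inl i))%:R.
  (* Large enough for the difference of coordinates i and j to exceed M. *)
  pose t : R := Num.max 0 (M - p 0 i + p 0 j) + 1.
  have t0 : 0 <= t by rewrite addr_ge0 // le_max lexx.
  pose q : 'rV[R]_d := \row_l (p 0 l + t * v l).
  have qE l : q 0 l = p 0 l + t * v l by rewrite mxE.
  have Cq : cell A (fine_type A p) q.
    apply/cellE => i' j' k ik jk; rewrite !qE.
    have := (cellE p p).1 (@cell_self p) i' j' k ik jk.
    have : t * v j' <= t * v i'.
      apply: ler_wpM2l => //; rewrite /v ler_nat.
      have := UT _ _ ik; have := UB _ _ jk.
      by do 3 case: (U _) => //; move=> h1 h2; case: (notF (h2 (h1 isT))).
    lra.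
  have := XM q Cq i j; rewrite !qE /v iU (negPf jU) mulr1 mulr0.
  have : M - p 0 i + p 0 j <= Num.max 0 (M - p 0 i + p 0 j) by rewrite le_max lexx orbT.
  rewrite /t; lra.
apply/(torus_boundedP _ i0).
pose C := cell A (fine_type A p).
pose h (q : 'rV[R]_d) (x : 'I_d + 'I_n) : R := match x with
  | inl i => q 0 i | inr k => q 0 (sector_of p k) - a (sector_of p k, k) end.
have hb x y : exists M, forall q, C q -> h q x - h q y <= M.
  have /connectP[s ps ->] := sc x y.
  elim: s x ps => [|z s IH] x /=; first by exists 0 => q _; rewrite subrr.
  move=> /andP[xz /IH[M hM]].
  have [M' hM'] : exists M', forall q, C q -> h q x - h q z <= M'.
    clear IH hM; case: x z xz => [i|k] [j|l] // xz.
      exists (a (i, l)) => q /cellE /(_ _ i l (sector_ofP p l)).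
      by rewrite -(recession_arc _ _ TB) => /(_ xz) /=; lra.
    exists (- a (j, k)) => q Cq; have := cell_tight Cq xz; rewrite /h; lra.
  exists (M' + M) => q Cq; have := hM q Cq; have := hM' q Cq; lra.
have [M hM] := choice (fun xy : 'I_d * 'I_d => hb (inl xy.1) (inl xy.2)).
exists (\sum_xy `|M xy|) => q Cq i j; apply: le_trans (hM (i, j) q Cq) _.
apply: le_trans (ler_norm _) _; rewrite (bigD1 (i, j)) //= lerDl.
exact: sumr_ge0.
Qed.

End Cells.

(** * The dimension of the bounded subcomplex *)

Theorem theoremA (R : realType) (d n : nat) (B : {set 'I_d * 'I_n})
    (hB : connected_graph B) (A : 'M[\bar R]_(d, n))
    (hA : tropical_matrix A) (hBA : B = support_graph A) :
  complex_dim (bounded_subcomplex A)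
    <= (recession_connectivity (support_graph A))%:Z - 1
  /\ (sufficiently_generic A ->
      complex_dim (bounded_subcomplex A)
        = (recession_connectivity (support_graph A))%:Z - 1).
Proof.
have [i0] : exists i0 : 'I_d, True.
  case/andP: hB => /card_gt0P[[i|k] _] _; first by exists i.
  by have [i _] := hA.2 k; exists i.
move=> _; set lam := recession_connectivity _.
have upper : complex_dim (bounded_subcomplex A) <= lam%:Z - 1.
  rewrite /complex_dim lerD2r lez_nat; apply/bigmax_leqP => k /asboolP.
  move=> [C [[p ->] bdd]]; have [m [_ -> ind _]] := torus_dimP (cell A (fine_type A p)).
  move=> /(addIr (-1)) [<-].
  apply: leq_trans (independent_le_components hA i0 ind) _.
  apply: (leq_bigmax_cond (F := @num_components d n)).
  by rewrite type_graph_sub //=; apply/bounded_strongly_connected.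
split=> // gen; apply/eqP; rewrite eq_le upper /=.
have [S /andP[SB scS] ->] : exists2 S : {set 'I_d * 'I_n}, (S \subset support_graph A) &&
    strongly_connected (recession_graph S (support_graph A)) & lam = num_components S.
  have [|S PS mE] := @eq_bigmax_cond _ [pred S : {set 'I_d * 'I_n} |
    (S \subset support_graph A) &&
    strongly_connected (recession_graph S (support_graph A))] (@num_components d n).
    apply/card_gt0P; exists (support_graph A); rewrite inE fintype.subxx /=.
    apply/strongly_connectedP => x y; rewrite -hBA.
    case/andP: hB => _ /forallP/(_ x)/forallP/(_ y); apply: connect_sub => z t zt.
    apply: connect1; case: z t zt => [i|k] [j|l] //= ->; by rewrite orbT.
  by exists S => //; rewrite -mE; apply: eq_bigl => S'; rewrite inE.
have [F [FB scF leF]] := exists_small_support SB scS.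
pose o (e : 'I_d * 'I_n) : nat := e \in F.
have oF : edge_support o = F.
  by apply/setP => e; rewrite inE /o; case: (e \in F).
have [|f [p [w [fo pw]]]] := @strict_complementarity R d n A o gen; first by rewrite oF.
pose P : 'rV[R]_d := \row_i p i.
have scf : strongly_connected (recession_graph (edge_support f) (support_graph A)).
  rewrite -(edge_support_natr R f).
  apply: (@recession_transport R _ _ _ (fun e => (o e)%:R)) => //;
    rewrite ?edge_support_natr ?oF //; first exact: fo.1.
  exact: natr_margins fo.2.
(* A right node can only be left along an edge of supp f. *)
have f_nbr k : exists i, f (i, k) != 0.
  have /connectP[[//|y s] /= /andP[ky _] _] :=
    (strongly_connectedP _ scf) (inr k) (inl i0).
  by case: y ky => // i; rewrite inE; exists i.
have TF : type_graph A P = edge_support f.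
  apply/setP => -[i k]; apply/idP/idP => [/(in_type_graph hA)[ik imax]|].
    rewrite inE; apply/(pw _ _ ik).2; have [j jk] := f_nbr k.
    have jB : (j, k) \in support_graph A by rewrite (fintype.subsetP fo.1) // inE.
    have := imax j jB; rewrite !mxE.
    have := (pw _ _ jB).2.1 jk; have := (pw _ _ ik).1.
    move=> h1 h2 h3; apply/eqP; rewrite eq_le h1 /= -h2 h3 //.
  move=> ef; have ik := fintype.subsetP fo.1 _ ef; apply/(in_type_graph hA).
  split=> // j jk; rewrite !mxE; rewrite inE in ef.
  by have := (pw _ _ ik).2.1 ef => /= ->; exact: (pw _ _ jk).1.
have ge_c : (num_components S <= num_components (type_graph A P))%N.
  have fF : (#|edge_support f| <= #|F|)%N.
    have -> : #|F| = (\sum_e o e)%N by rewrite -sum1_card big_mkcond.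
    rewrite -(feasible_sum fo) -sum1_card big_mkcond /=; apply: leq_sum => e _.
    by rewrite inE -lt0n; case: ifP.
  have := @vertices_le_components_edges rat d n (type_graph A P); rewrite {2}TF => h.
  rewrite -(leq_add2r #|F|) addnC; apply: leq_trans leF _.
  by apply: leq_trans h _; rewrite leq_add2l.
have [m [md mE ind mmax]] := torus_dimP (cell A (fine_type A P)).
have cm := mmax _ (num_components_type_graph hA P) (cell_independent hA P).
rewrite /complex_dim lerD2r lez_nat.
apply: leq_trans ge_c _; apply: leq_trans cm _.
have md' : (m < d.+1)%N by rewrite ltnS.
apply: (@leq_bigmax_cond _ _ (fun k : 'I_d.+1 => k : nat) (Ordinal md')).
apply/asboolP; exists (cell A (fine_type A P)) => //.
split; first by exists P.
by apply/bounded_strongly_connected => //; rewrite TF.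
Qed.
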